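(* Let $q\ge1$ and let $\theta_0^b$, $b\in\{0,1\}^q$, be the efficiency scores of $DMU_0$ under the specifications $b$ of the DEA model. The maximum entropy expected efficiency score $E^e(\Theta_0)$, i.e. the expected efficiency score $E_p(\Theta_0)$ evaluated at the probability vector $p\in[0,1]^q$ at which the entropy function $H$ attains its maximum, is $$E^e(\Theta_0)=\frac{1}{2^q}\sum_{b\in\{0,1\}^q}\theta_0^b .$$
   Context: Setting: $n$ decision making units (DMUs) are described by nonnegative input and output data $x_{ij}$, $y_{rj}$. The (CCR) DEA efficiency score of $DMU_0$ is the optimal value of the linear program: minimize $\theta_0$ subject to $\sum_{j=1}^n\lambda_jx_{ij}\le\theta_0x_{i0}$ for every included input $i$, $\sum_{j=1}^n\lambda_jy_{rj}\ge y_{r0}$ for every included output $r$, and $\lambda_j\ge0$ for all $j$. There are $q$ candidate variables $z_1,\dots,z_q$, each an input or an output. For $b\in\{0,1\}^q$, $\theta_0^b$ is the (real) score of $DMU_0$ when exactly the candidates $z_c$ with $b_c=1$ are included; by convention $\theta_0^{(0,\dots,0)}=1$. Candidate $z_c$ is included with probability $p_c\in[0,1]$, independently over $c$; the scenario $b$ has probability $P_p(\Theta_0=\theta_0^b):=\prod_{c=1}^qp_c^{b_c}(1-p_c)^{1-b_c}$, where $\Theta_0$ is the random score taking the value $\theta_0^b$ in scenario $b$ (scenarios are counted separately even if scores coincide). The expected efficiency score is $$E_p(\Theta_0)=\sum_{b\in\{0,1\}^q}\Big(\prod_{c=1}^qp_c^{b_c}(1-p_c)^{1-b_c}\Big)\theta_0^b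 .$$ The entropy function is $H(p)=-\sum_{b\in\{0,1\}^q}P_p(\Theta_0=\theta_0^b)\log P_p(\Theta_0=\theta_0^b)$ for $p=(p_1,\dots,p_q)\in[0,1]^q$, with the conventions $0^0=1$ and $0\log0=0$. *)

(* Defs.v *)
From HB Require Import structures.
From mathcomp Require Import all_boot all_order all_algebra.
From mathcomp Require Import all_classical all_reals all_analysis.

Set Implicit Arguments.
Unset Strict Implicit.
Unset Printing Implicit Defensive.

Import Order.TTheory GRing.Theory Num.Theory.

Local Open Scope ring_scope.

Notation scenario q := {ffun 'I_q -> bool}.

Section DEA.
Variables (R : realType) (n m s q : nat).
Variables (x : 'M[R]_(m, n)) (y : 'M[R]_(s, n)) (o : 'I_n).
(* [inl i] stands for the input i, [inr r] for the output r; z lists the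
   candidates. *)
Variable z : 'I_q -> 'I_m + 'I_s.

(* Variables that are not candidates, if there are any, belong to every
   specification; if z is onto, only the selected candidates are included. *)
Definition included (b : scenario q) (v : 'I_m + 'I_s) : bool :=
  (v \notin codom z) || [exists c, (z c == v) && b c].

Definition ccr_feasible (b : scenario q) (theta : R) (lambda : 'I_n -> R) :
    Prop :=
  [/\ forall j, 0 <= lambda j,
      forall i, included b (inl i) ->
        \sum_j lambda j * x i j <= theta * x i o
    & forall r, included b (inr r) ->
        y r o <= \sum_j lambda j * y r j].

Definition ccr_optimal_value (b : scenario q) (t : R) : Prop :=
  (exists lambda, ccr_feasible b t lambda) /\
  (forall theta lambda, ccr_feasible b theta lambda -> t <= theta).

(* The score of the specification without candidates is 1 by convention,
   whatever the value of the corresponding program. *)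
Definition is_score (b : scenario q) (t : R) : Prop :=
  if b == [ffun=> false] then t = 1 else ccr_optimal_value b t.

End DEA.

Section Entropy.
Variables (R : realType) (q : nat).
Implicit Types (p : {ffun 'I_q -> R}) (b : scenario q).

Definition scenario_prob p b : R :=
  \prod_c (p c ^+ b c * (1 - p c) ^+ (1 - b c)%N).

Definition expected_score (theta : scenario q -> R) p : R :=
  \sum_(b : scenario q) scenario_prob p b * theta b.

Definition entropy p : R :=
  - \sum_(b : scenario q) scenario_prob p b * ln (scenario_prob p b).

Definition prob_vector p : Prop := forall c, 0 <= p c <= 1.

Definition max_entropy p : Prop :=
  prob_vector p /\ forall p', prob_vector p' -> entropy p' <= entropy p.

End Entropy.

(* Main.v *)
Require Import Defs.
From HB Require Import structures.
From mathcomp Require Import all_boot all_order all_algebra.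
From mathcomp Require Import all_classical all_reals all_analysis.
From mathcomp Require Import ring lra.

(** For a probability vector p the scenario probabilities are nonnegative and
    add up to 1, the sum of the products over all scenarios factoring as
    the product of the sums p c + (1 - p c).  So H(p) is the Shannon entropy of
    a law on 2^q points, and Gibbs' inequality bounds it by ln (2^q), with
    equality exactly for the uniform law ([leif_shannon]).  Among the product
    laws considered here the uniform one occurs once, at p = (1/2, ..., 1/2):
    if all scenarios are equally likely, flipping the choice for one candidate
    c does not change the probability of a scenario, which forces
    p c = 1 - p c ([uniform_scenario_prob]).  Hence this p is the only maximizer
    of H ([max_entropyE]), and the expectation at it is the plain average of
    the scores. *)

Set Implicit Arguments.
Unset Strict Implicit.
Unset Printing Implicit Defensive.

Import Order.TTheory GRing.Theory Num.Theory.

Local Open Scope ring_scope.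

(** By strict convexity the graph of exp meets its tangent line at 0 only at 0;
    this is applied at ln t. *)
Lemma leif_ln_sub1 (R : realType) (t : R) :
  0 < t -> ln t <= t - 1 ?= iff (t == 1).
Proof.
move=> t0; apply/leifP; case: eqVneq => [->|t1]; first by rewrite ln1 subrr.
have lnt0 : ln t != 0 by rewrite ln_eq0.
by have := expR_gt1Dx lnt0; rewrite lnK ?posrE//; lra.
Qed.

(** The tangent bound for ln at t = 1 / (N w), multiplied by w.  The right-hand
    side is arranged so that summing it over N weights of total 1 gives ln N. *)
Lemma leif_neg_mul_ln (R : realType) (N w : R) : 0 < N -> 0 <= w ->
  - (w * ln w) <= N^-1 - w + w * ln N ?= iff (w == N^-1).
Proof.
move=> N0; rewrite le_eqVlt => /predU1P[<-|w0].
  apply/leifP; rewrite eq_sym invr_eq0 gt_eqF// !(mul0r, oppr0, addr0).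
  by rewrite invr_gt0.
have Nw0 : 0 < N * w by rewrite mulr_gt0.
have t0 : 0 < (N * w)^-1 by rewrite invr_gt0.
have lnt : ln (N * w)^-1 = - (ln N + ln w) by rewrite lnV ?lnM ?posrE.
have wt : w * ((N * w)^-1 - 1) = N^-1 - w by field; rewrite !gt_eqF.
have -> : (w == N^-1) = ((N * w)^-1 == 1).
  rewrite invr_eq1; apply/eqP/eqP => [->|Nw1]; first by rewrite mulfV ?gt_eqF.
  by apply: (mulfI (lt0r_neq0 N0)); rewrite Nw1 mulfV ?gt_eqF.
have -> : - (w * ln w) = w * ln (N * w)^-1 + w * ln N by rewrite lnt; ring.
have [le_ln eq_ln] := leif_ln_sub1 t0.
rewrite -wt; split; first by rewrite lerD2r ler_pM2l.
by rewrite (inj_eq (addIr _)) (inj_eq (mulfI (lt0r_neq0 w0))).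
Qed.

(** Gibbs' inequality against the uniform law.  Summing the pointwise bounds
    with N = #|T|, the terms 1/N - w i cancel in total because both laws have
    mass 1; equality of the sums forces equality in every term. *)
Lemma leif_shannon (R : realType) (T : finType) (w : T -> R) :
  (forall i, 0 <= w i) -> \sum_i w i = 1 ->
  - \sum_i w i * ln (w i) <= ln #|T|%:R
      ?= iff [forall i, w i == #|T|%:R^-1].
Proof.
move=> w0 w1.
have N0 : 0 < #|T|%:R :> R.
  rewrite ltr0n lt0n; apply/eqP => /card0_eq T0.
  by have := @oner_neq0 R; rewrite -w1 big_pred0 ?eqxx// => i; have := T0 i.
rewrite -sumrN.
have -> : ln #|T|%:R = \sum_i (#|T|%:R^-1 - w i + w i * ln #|T|%:R) :> R.
  rewrite big_split/= sumrB -mulr_suml w1 sumr_const -[_^-1 *+ _]mulr_natl.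
  by rewrite mulfV ?gt_eqF// subrr add0r mul1r.
by apply: leif_sum => i _; apply: leif_neg_mul_ln.
Qed.

Section ProductLaw.
Variables (R : realType) (q : nat).
Implicit Types (p : {ffun 'I_q -> R}) (b : scenario q).

Lemma scenario_prob_ge0 p b : prob_vector p -> 0 <= scenario_prob p b.
Proof.
move=> pP; apply: prodr_ge0 => c _; have /andP[p0 p1] := pP c.
by rewrite mulr_ge0 ?exprn_ge0 ?subr_ge0.
Qed.

Lemma sum_scenario_prob p : \sum_b scenario_prob p b = 1.
Proof.
have := bigA_distr_bigA (fun c (v : bool) => p c ^+ v * (1 - p c) ^+ (1 - v)%N).
rewrite /scenario_prob => <-; apply: big1 => c _.
by rewrite big_bool /= !expr1 !expr0 mulr1 mul1r addrC subrK.
Qed.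

Lemma card_scenario : #|{: scenario q}| = (2 ^ q)%N.
Proof. by rewrite card_ffun card_bool card_ord. Qed.

Definition half_vector : {ffun 'I_q -> R} := [ffun=> 2^-1].

Lemma prob_vector_half : prob_vector half_vector.
Proof. by move=> c; rewrite ffunE; lra. Qed.

Lemma scenario_prob_half b : scenario_prob half_vector b = (2 ^+ q)^-1.
Proof.
rewrite /scenario_prob -exprVn.
rewrite (eq_bigr (fun=> 2^-1)) ?prodr_const ?card_ord// => c _.
by rewrite ffunE; case: (b c); rewrite /= ?expr1 ?expr0; lra.
Qed.

(** The scenarios with everything included and with everything but c included
    have probabilities that differ only by a factor p c against 1 - p c; the
    remaining factor is nonzero because the common value 2^-q is, so it cancels
    and gives p c = 1 - p c. *)
Lemma uniform_scenario_prob p :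
  (forall b, scenario_prob p b = (2 ^+ q)^-1) -> p = half_vector.
Proof.
move=> unif; apply/ffunP => c; rewrite ffunE.
have unif_c (v : bool) :
    p c ^+ v * (1 - p c) ^+ (1 - v)%N * \prod_(d | d != c) p d = (2 ^+ q)^-1.
  rewrite -(unif [ffun d => (d != c) || v]) /scenario_prob [RHS](bigD1 c)//=.
  rewrite ffunE eqxx; congr (_ * _); apply: eq_bigr => d dc.
  by rewrite ffunE dc /= expr1 mulr1.
have rest0 : \prod_(d | d != c) p d != 0.
  apply/eqP => r0; have /eqP := unif_c true.
  by rewrite r0 mulr0 eq_sym invr_eq0 expf_eq0 pnatr_eq0 andbF.
have := mulIf rest0 (etrans (unif_c true) (esym (unif_c false))).
by rewrite /= !expr1 !expr0; lra.
Qed.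

Lemma leif_entropy p : prob_vector p ->
  entropy p <= ln (2 ^+ q) ?= iff (p == half_vector).
Proof.
move=> pP.
have := leif_shannon (fun b => scenario_prob_ge0 b pP) (sum_scenario_prob p).
rewrite card_scenario natrX; congr (_ <= _ ?= iff _).
apply/forallP/eqP => [unif|-> b]; last by rewrite scenario_prob_half.
by apply: uniform_scenario_prob => b; apply/eqP.
Qed.

Lemma max_entropyE p : max_entropy p <-> p = half_vector.
Proof.
have hP := prob_vector_half.
have Hhalf : entropy half_vector = ln (2 ^+ q).
  by apply/eqP; rewrite (leif_entropy hP).
split=> [[pP pmax]|->].
  apply/eqP; rewrite -(leif_entropy pP) eq_le (leif_entropy pP) -Hhalf.
  exact: pmax.
by split=> // p' p'P; rewrite Hhalf (leif_entropy p'P).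
Qed.

Lemma expected_score_half (theta : scenario q -> R) :
  expected_score theta half_vector = 1 / 2 ^+ q * \sum_b theta b.
Proof.
rewrite mulr_sumr; apply: eq_bigr => b _.
by rewrite scenario_prob_half div1r.
Qed.

End ProductLaw.

Theorem corollary4p1 (R : realType) (n m s q : nat) (hq : (1 <= q)%N)
    (x : 'M[R]_(m, n)) (y : 'M[R]_(s, n))
    (hx : forall i j, 0 <= x i j) (hy : forall r j, 0 <= y r j)
    (o : 'I_n) (z : 'I_q -> 'I_m + 'I_s) (hz : injective z)
    (theta : scenario q -> R)
    (htheta : forall b : scenario q, is_score x y o z b (theta b)) :
  (exists! p : {ffun 'I_q -> R}, max_entropy p) /\
  (forall p : {ffun 'I_q -> R}, max_entropy p ->
     expected_score theta p = 1 / 2 ^+ q * \sum_(b : scenario q) theta b).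
Proof.
split=> [|p /max_entropyE ->]; last exact: expected_score_half.
exists (half_vector R q); split; first by apply/max_entropyE.
by move=> p /max_entropyE ->.
Qed.
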